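(* $V_6=\displaystyle\inf_{a\in[1.6456659,\,1.8231801]}\frac{r_2(a)}{(\sqrt a-1)^2}=34.8992259$. The infimum is attained at the point $r=(0.2114174,0.5028451,0.6363167,0.5028452,0.2114174,0,0)\in\mathbb{R}^7$, which corresponds to the cosine polynomial $f(\phi)=\sum_{k=0}^6 a_k\cos k\phi\in C_6$ with $a_0=1$, $a_1=1.7051159$, $a_2=1.0438202$, $a_3=0.4252409$, $a_4=0.0893946$, $a_5=0$, $a_6=0$.
   Context: For an integer $n\ge 2$, $C_n$ denotes the set of real cosine polynomials $f(\phi)=\sum_{k=0}^{n} a_k\cos(k\phi)$ such that (i) all coefficients are real and nonnegative, (ii) $a_1>a_0>0$, and (iii) $f(\phi)\ge 0$ for all real $\phi$. For $f\in C_n$, $v(f)=\dfrac{f(0)-a_0}{(\sqrt{a_1}-\sqrt{a_0})^2}$ and $V_n=\inf_{f\in C_n}v(f)$. For real $a$, $r_2(a)$ is the minimum of $F(\mathbf x)=(x_0+\dots+x_6)^2-1$ over $\mathbf x=(x_0,\dots,x_6)\in\mathbb{R}^7$ subject to $\sum_{i=0}^6x_i^2=1$, $2(x_0x_1+x_1x_2+\dots+x_5x_6)=a$, $2(x_0x_5+x_1x_6)\ge0$, and $2x_0x_6\ge 0$. A point $\mathbf x\in\mathbb{R}^{n+1}$ corresponds to the cosine polynomial $|\sum_{k=0}^n x_k e^{ik\phi}|^2=a_0+\sum_{j\ge1}a_j\cos j\phi$ with $a_0=\sum_k x_k^2$ and $a_j=2\sum_{k}x_kx_{k+j}$. Numerical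 constants are decimal values as given in the paper, to seven decimal places. *)

(* Defs.v *)
From HB Require Import structures.
From mathcomp Require Import all_boot all_order all_algebra.
From mathcomp Require Import complex ring.
From mathcomp Require Import all_classical all_reals all_analysis.

Set Implicit Arguments.
Unset Strict Implicit.
Unset Printing Implicit Defensive.

Import Order.TTheory GRing.Theory Num.Theory.
Import numFieldNormedType.Exports.

Local Open Scope classical_set_scope.
Local Open Scope ring_scope.

(* A decimal with seven digits after the point: [dec7 N] is N * 10^-7.  The
   digits are passed as a [nat] constant, so 1.6456659 is [dec7 16456659]. *)
Definition dec7 {R : realType} (N : nat) : R := N%:R / 10 ^+ 7.

(* "x = d" for a printed seven-place decimal d: x differs from d by less than
   one unit of the seventh decimal place.  Half a unit would be too strict,
   because the quoted constants are not all correctly rounded; for instance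
   0.5028451 and 0.5028452 are quoted for two coordinates that are equal. *)
Definition eq7 {R : realType} (x d : R) : Prop := `|x - d| < dec7 1.

Section CosinePolynomials.
Context {R : realType} {n : nat}.
Implicit Types a x : 'rV[R]_n.+1.

(* The k-th entry of a row vector, k <= n; [inord] sends an out of range index
   to 0, so this is only meaningful for k <= n. *)
Definition entry a (k : nat) : R := a ord0 (inord k).

(* A cosine polynomial of degree at most n is represented by its vector of
   coefficients (a_0, ..., a_n), which it determines uniquely. *)
Definition cospoly a (phi : R) : R :=
  \sum_(k < n.+1) entry a k * cos (k%:R * phi).

(* The quantity v(f). *)
Definition vratio a : R :=
  (cospoly a 0 - entry a 0) / (Num.sqrt (entry a 1) - Num.sqrt (entry a 0)) ^+ 2.

(* The coefficients of the cosine polynomial attached to a point x, namely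
   |sum_k x_k e^(i k phi)|^2; see [cospoly_sqmod] below. *)
Definition sqmod_coef x : 'rV[R]_n.+1 :=
  \row_(j < n.+1)
    if j == 0 :> nat then \sum_(k < n.+1) entry x k ^+ 2
    else 2 * \sum_(k < n.+1 - j) entry x k * entry x (k + j).

End CosinePolynomials.

(* The class C_n and the constant V_n; they are meant for n >= 2. *)
Definition cosC (R : realType) (n : nat) : set 'rV[R]_n.+1 :=
  [set a | [/\ forall k : 'I_n.+1, 0 <= entry a k,
               0 < entry a 0 < entry a 1
             & forall phi : R, 0 <= cospoly a phi]].
Arguments cosC : clear implicits.

Definition cosV (R : realType) (n : nat) : R := inf (vratio @` cosC R n).

Section ProblemR2.
Context {R : realType}.

Definition F2 (x : 'rV[R]_7) : R := (\sum_(i < 7) entry x i) ^+ 2 - 1.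

Definition feasible2 (a : R) : set 'rV[R]_7 :=
  [set x | [/\ \sum_(i < 7) entry x i ^+ 2 = 1,
               2 * \sum_(i < 6) entry x i * entry x i.+1 = a,
               0 <= 2 * (entry x 0 * entry x 5 + entry x 1 * entry x 6)
             & 0 <= 2 * (entry x 0 * entry x 6)]].

(* The minimum of F2 over the feasible points; it is indeed attained as soon as
   there are such points, by [r2_attained] below (by convention r2 a = 0 when
   there are none). *)
Definition r2 (a : R) : R := inf (F2 @` feasible2 a).

Definition ratio2 (a : R) : R := r2 a / (Num.sqrt a - 1) ^+ 2.

End ProblemR2.

Section Facts.
Context {R : realType}.

Lemma sum_symmetric (N : nat) (G : nat -> nat -> R) :
  (forall k l, G k l = G l k) ->
  \sum_(k < N) \sum_(l < N) G k l =
  \sum_(k < N) G k k + \sum_(1 <= j < N) 2 * \sum_(k < N - j) G k (k + j)%N.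
Proof.
move=> Gsym; elim: N => [|N IH]; first by rewrite !big_ord0 big_geq // addr0.
rewrite big_ord_recr /=.
under eq_bigr do rewrite big_ord_recr /=.
rewrite big_split /= IH [X in _ + X]big_ord_recr /= [X in _ = X + _]big_ord_recr /=.
have -> : \sum_(1 <= j < N.+1) 2 * (\sum_(k < N.+1 - j) G k (k + j)%N) =
    \sum_(1 <= j < N) 2 * (\sum_(k < N - j) G k (k + j)%N) +
    2 * \sum_(k < N) G k N.
  have -> : \sum_(k < N) G k N = \sum_(1 <= j < N.+1) G (N - j)%N N.
    rewrite -(big_mkord xpredT (fun k => G k N)) big_nat_rev /= add0n.
    by rewrite big_add1.
  rewrite mulr_sumr.
  have -> : \sum_(1 <= j < N) 2 * (\sum_(k < N - j) G k (k + j)%N) =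
      \sum_(1 <= j < N.+1) 2 * (\sum_(k < N - j) G k (k + j)%N).
    case: N {IH} => [|N]; first by rewrite !big_geq.
    by rewrite [RHS]big_nat_recr //= subnn big_ord0 mulr0 addr0.
  rewrite -big_split /=; apply: eq_big_nat => j /andP[_ jN].
  by rewrite subSn // big_ord_recr /= subnK // mulrDr.
have -> : \sum_(l < N) G N l = \sum_(k < N) G k N.
  by apply: eq_bigr => k _; exact: Gsym.
rewrite [2 * \sum_(k < N) _]mulr_natl mulr2n.
set A := \sum_(k < N) G k k; set B := \sum_(1 <= j < N) _.
set D := \sum_(k < N) G k N.
by ring.
Qed.

Lemma sum_complex (m : nat) (f g h : nat -> R) :
  \sum_(k < m) ((f k)%:C * (g k +i* h k))%C =
  ((\sum_(k < m) f k * g k) +i* (\sum_(k < m) f k * h k))%C.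
Proof.
elim: m => [|m IH]; first by rewrite !big_ord0.
rewrite !big_ord_recr /= IH.
by apply/eqP; rewrite eq_complex /= !mul0r subr0 addr0 !eqxx.
Qed.

Lemma cospoly_sqmod (n : nat) (x : 'rV[R]_n.+1) (phi : R) :
  cospoly (sqmod_coef x) phi =
  ComplexField.Normc.normc
    (\sum_(k < n.+1) ((entry x k)%:C * (cos (k%:R * phi) +i* sin (k%:R * phi)))%C)
    ^+ 2.
Proof.
set z := \sum_(k < _) _.
have zE : z = ((\sum_(k < n.+1) entry x k * cos (k%:R * phi))
              +i* (\sum_(k < n.+1) entry x k * sin (k%:R * phi)))%C.
  exact: (sum_complex _ (entry x) (fun k => cos (k%:R * phi))
    (fun k => sin (k%:R * phi))).
rewrite zE /= sqr_sqrtr; last by rewrite addr_ge0 ?sqr_ge0.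
pose G k l := entry x k * entry x l * cos (k%:R * phi - l%:R * phi).
have -> : (\sum_(k < n.+1) entry x k * cos (k%:R * phi)) ^+ 2 +
    (\sum_(k < n.+1) entry x k * sin (k%:R * phi)) ^+ 2 =
    \sum_(k < n.+1) \sum_(l < n.+1) G k l.
  rewrite !expr2 !mulr_suml -big_split /=; apply: eq_bigr => k _.
  rewrite !mulr_sumr -big_split /=; apply: eq_bigr => l _.
  by rewrite /G cosB mulrDr !mulrA [entry x k * cos _ * _]mulrAC
    [entry x k * sin _ * _]mulrAC.
rewrite sum_symmetric => [|k l]; last first.
  by rewrite /G -cosN opprB [entry x k * _]mulrC.
rewrite /cospoly -(big_mkord xpredT
  (fun k => entry (sqmod_coef x) k * cos (k%:R * phi))) big_nat_recl // big_add1 /=.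
congr (_ + _).
  rewrite /entry mxE inordK // mul0r cos0 mulr1; apply: eq_bigr => k _.
  by rewrite /G subrr cos0 mulr1 expr2.
apply: eq_big_nat => j jn.
rewrite {1}/entry mxE inordK // -mulrA mulr_suml; congr (2 * _).
by apply: eq_bigr => k _; rewrite /G natrD mulrDl opprD addrA subrr add0r cosN.
Qed.

Lemma continuous_entry (n k : nat) :
  continuous (fun x : 'rV[R]_n.+1 => entry x k).
Proof. by move=> x; exact: coord_continuous. Qed.

Lemma continuous_bigsum (T : topologicalType) (m : nat) (f : nat -> T -> R) :
  (forall i, continuous (f i)) -> continuous (fun x => \sum_(i < m) f i x).
Proof.
move=> fc; apply: (@continuous_big R _ +%R 0 xpredT _ T _ (fun i : 'I_m => f i)).
  by move=> x; exact: add_continuous.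
by move=> i _; exact: fc.
Qed.

Lemma continuous_addf (T : topologicalType) (f g : T -> R) :
  continuous f -> continuous g -> continuous (fun x => f x + g x).
Proof. by move=> fc gc x; apply: cvgD; [exact: fc|exact: gc]. Qed.

Lemma continuous_mulf (T : topologicalType) (f g : T -> R) :
  continuous f -> continuous g -> continuous (fun x => f x * g x).
Proof. by move=> fc gc x; apply: cvgM; [exact: fc|exact: gc]. Qed.

Lemma r2_attained (a : R) : feasible2 a !=set0 ->
  exists2 x, feasible2 a x & F2 x = r2 a /\ forall y, feasible2 a y -> F2 x <= F2 y.
Proof.
move=> feas0.
have ec k : continuous (fun x : 'rV[R]_7 => entry x k) by exact: continuous_entry.
have cc (c : R) : continuous (fun _ : 'rV[R]_7 => c) by exact: cst_continuous.
have Mc k l : continuous (fun x : 'rV[R]_7 => entry x k * entry x l).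
  exact: continuous_mulf.
have F2c : continuous (F2 : 'rV[R]_7 -> R).
  have Sc := @continuous_bigsum _ 7 _ ec.
  exact: (continuous_addf (continuous_mulf Sc Sc) (cc _)).
have sqc : continuous (fun x : 'rV[R]_7 => \sum_(i < 7) entry x i ^+ 2).
  exact: (@continuous_bigsum _ 7 _ (fun i => Mc i i)).
have cadj : continuous (fun x : 'rV[R]_7 =>
    2 * \sum_(i < 6) entry x i * entry x i.+1).
  exact: (continuous_mulf (cc 2) (@continuous_bigsum _ 6 _ (fun i => Mc i i.+1))).
have c5 : continuous (fun x : 'rV[R]_7 =>
    2 * (entry x 0 * entry x 5 + entry x 1 * entry x 6)).
  exact: (continuous_mulf (cc 2) (continuous_addf (Mc 0 5) (Mc 1 6))).
have c6 : continuous (fun x : 'rV[R]_7 => 2 * (entry x 0 * entry x 6)).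
  exact: (continuous_mulf (cc 2) (Mc 0 6)).
have feasE : feasible2 a =
    ((fun x : 'rV[R]_7 => \sum_(i < 7) entry x i ^+ 2) @^-1` [set 1]) `&`
    ((fun x : 'rV[R]_7 => 2 * \sum_(i < 6) entry x i * entry x i.+1) @^-1` [set a])
    `&` ((fun x : 'rV[R]_7 =>
      2 * (entry x 0 * entry x 5 + entry x 1 * entry x 6)) @^-1` [set t | 0 <= t])
    `&` ((fun x : 'rV[R]_7 => 2 * (entry x 0 * entry x 6)) @^-1` [set t | 0 <= t]).
  by apply/seteqP; split => x /=; [case=> ? ? ? ?|case=> [[[? ?] ?] ?]]; split.
have feasc : compact (feasible2 a).
  apply: bounded_closed_compact.
    exists 1; split; first exact: num_real.
    move=> M M1 x [nx _ _ _]; apply: le_trans (ltW M1).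
    rewrite [leLHS]/Num.norm /= mx_normrE; apply/bigmax_leP; split=> //= -[i j] _ /=.
    rewrite ord1 -(ler_pXn2r (_ : 0 < 2)%N) ?nnegrE // expr1n real_normK ?num_real //.
    rewrite -nx (bigD1 j) //= /entry inord_val lerDl.
    by apply: sumr_ge0 => ? _; exact: sqr_ge0.
  rewrite feasE; do 3?[apply: closedI].
  - by apply: preimage_closed => [? _|]; [by []|]; exact: closed_eq.
  - by apply: preimage_closed => [? _|]; [by []|]; exact: closed_eq.
  - by apply: preimage_closed => [? _|]; [by []|]; exact: closed_ge.
  - by apply: preimage_closed => [? _|]; [by []|]; exact: closed_ge.
have [x + xmin] := EVT_min_rV feas0 feasc (continuous_subspaceT F2c).
rewrite inE => xF; exists x => //.
have {}xmin y : feasible2 a y -> F2 x <= F2 y by move=> yF; apply: xmin; rewrite inE.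
split=> //; apply/eqP; rewrite eq_le; apply/andP; split.
  apply: lb_le_inf; first by exists (F2 x), x.
  by move=> _ [y yF <-]; exact: xmin.
apply: ge_inf; last by exists x.
by exists (F2 x) => _ [y yF <-]; exact: xmin.
Qed.

End Facts.

(* Main.v *)
(** Write the coefficients of f in the Chebyshev basis, so that f >= 0 means
nonnegativity in c = cos phi on [-1, 1].  For a parameter t, let y solve
(Adj - t) y = w 1 on the path with five vertices; up to the common denominator
w = t (3 - t^2) one has y = (Y0, Y1, Y2, Y1, Y0), with sum A
(in the code w is Yden t and A is Ysum t).  The roots of
4 Y0 c^2 + 2 Y1 c + Y2 - 2 Y0 carry a positive measure with moments
(w + t A, w - A, w, w, w, m5, m6) and m5, m6 <= w, whence the dual bound
A (a_1 - t a_0) <= w f(0) as soon as a_5, a_6 >= 0.  Choosing t with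
A (s - t) = w, where a_0 = 1 and a_1 = s^2, the bound becomes
f(0) - 1 >= W(t) (s - 1)^2 with W(t) = A s / (w (s - 1)) a rational function.
W has a unique critical point u in the relevant range, its minimum: the double
zero at u of W - W(u) is factored out explicitly.  At u the criticality
condition says exactly that the normalised vector y has second coefficient s^2,
so it is feasible and attains the bound.  Values of a_1 outside the range of
this one-parameter family leave room and are handled with the two extreme values
of t.  The bounds use only f >= 0 and a_5, a_6 >= 0, so they apply to r_2 as well
as to C_6. *)

Require Import Defs.
From mathcomp Require Import all_boot all_order all_algebra.
From mathcomp Require Import ring lra.
From mathcomp Require Import all_classical all_reals all_analysis.

Import Order.TTheory GRing.Theory Num.Theory.
Local Open Scope classical_set_scope.
Local Open Scope ring_scope.

(** * The two-point dual measures and the linear bounds they give *)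

Section DualFamily.
Context {R : rcfType}.
Implicit Types (t u c s : R).

Definition Ysum t : R := 5 * t ^+ 2 + 8 * t - 1.
Definition Yden t : R := t * (3 - t ^+ 2).
Definition Y0 t : R := t ^+ 2 + t - 1.
Definition Y1 t : R := t * (2 + t).
Definition Y2 t : R := (1 + t) ^+ 2.

(** The ends lie just inside the range where m5, m6 <= w: 27/25 is slightly above the root near
    1.078 of 2 t^3 + 4 t^2 - 2 t - 5 (see [moment6_le]), and 101/81 slightly below 2 cos(2 pi / 7),
    the positive root of [Y0 t = Yden t]. *)
Definition dual_range t := 27 / 25 <= t <= 101 / 81.

Lemma dual_range_pos t : dual_range t -> [/\ 0 < Ysum t, 0 < Yden t & 0 < Y0 t].
Proof.
move=> /andP[t1 t2]; rewrite /Ysum /Yden /Y0.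
have t3 : 0 <= (t - 27 / 25) * t by apply: mulr_ge0; lra.
have t4 : 0 <= (101 / 81 - t) * t by apply: mulr_ge0; lra.
by split; [lra|apply: mulr_gt0; lra|lra].
Qed.

Lemma Y0_le_Yden t : dual_range t -> Y0 t <= Yden t.
Proof.
move=> /andP[t1 t2]; rewrite /Yden /Y0.
have t3 : 0 <= (101 / 81 - t) * t by apply: mulr_ge0; lra.
have t4 : 0 <= (101 / 81 - t) * t ^+ 2 by apply: mulr_ge0; [lra|exact: sqr_ge0].
lra.
Qed.

Lemma moment6_le t : dual_range t -> Y1 t * (Yden t - Y0 t) <= Yden t * Y0 t.
Proof.
move=> /andP[t1 t2]; rewrite -subr_ge0.
have -> : Yden t * Y0 t - Y1 t * (Yden t - Y0 t) =
    t * (2 * t ^+ 3 + 4 * t ^+ 2 - 2 * t - 5) by rewrite /Yden /Y0 /Y1; ring.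
apply: mulr_ge0; first lra.
have t3 : 0 <= (t - 27 / 25) * t by apply: mulr_ge0; lra.
have t4 : 0 <= (t - 27 / 25) * t ^+ 2 by apply: mulr_ge0; [lra|exact: sqr_ge0].
lra.
Qed.

(** With c = cos phi this is e^(-2 i phi) times the sum of y_k e^(i k phi), so the cosine polynomial
    of y is its square. By complementary slackness the dual measure must sit on its zeros. *)
Definition node_poly t c : R := 4 * Y0 t * c ^+ 2 + 2 * Y1 t * c + (Y2 t - 2 * Y0 t).

Lemma node_poly_roots t a m b : a < m -> m < b ->
  0 <= node_poly t a -> node_poly t m < 0 -> 0 <= node_poly t b ->
  exists c1 c2, [/\ a <= c1 < m, m < c2 <= b, node_poly t c1 = 0 & node_poly t c2 = 0].
Proof.
move=> am mb qa qm qb.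
pose p : {poly R} :=
  (4 * Y0 t)%:P * 'X ^+ 2 + (2 * Y1 t)%:P * 'X + (Y2 t - 2 * Y0 t)%:P.
have pE c : p.[c] = node_poly t c.
  by rewrite /p !(hornerD, hornerM, hornerC, hornerXn, hornerX).
have neq c : node_poly t c = 0 -> c != m.
  by move=> qc; apply/eqP => cE; rewrite -cE qc ltxx in qm.
have [c1 /andP[ac1 c1m]] : exists2 x, a <= x <= m & root (- p) x.
  by apply: poly_ivt; [exact: ltW|rewrite !hornerN !pE oppr_le0 qa oppr_ge0 ltW].
rewrite rootE hornerN pE oppr_eq0 => /eqP q1.
have [c2 /andP[mc2 c2b]] : exists2 x, m <= x <= b & root p x.
  by apply: poly_ivt; [exact: ltW|rewrite !pE qb ltW].
rewrite rootE pE => /eqP q2.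
exists c1, c2; split => //; first by rewrite ac1 lt_neqAle neq.
by rewrite c2b lt_neqAle eq_sym neq // mc2.
Qed.

(** The Chebyshev polynomials of the first kind. *)
Fixpoint cheb (k : nat) c : R :=
  if k is k1.+1 then if k1 is k2.+1 then 2 * c * cheb k1 c - cheb k2 c else c
  else 1.

Lemma chebSS k c : cheb k.+2 c = 2 * c * cheb k.+1 c - cheb k c.
Proof. by []. Qed.

(* [c1] and [c2] are the roots of [node_poly t]; the weights are fixed by requiring
mass w + t A and first moment w - A, and the recurrence given by [node_poly t]
yields the others. *)
Lemma dual_measure t : dual_range t -> exists c1 c2 w1 w2 : R,
  [/\ -1 <= c1 <= 1, -1 <= c2 <= 1, 0 <= w1, 0 <= w2 &
   forall a : nat -> R, 0 <= a 5%N -> 0 <= a 6%N ->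
   \sum_(k < 7) a k * (w1 * cheb k c1 + w2 * cheb k c2) <=
   Yden t * \sum_(k < 7) a k - Ysum t * (a 1%N - t * a 0%N)].
Proof.
move=> tr; have [A0 w0 y0] := dual_range_pos _ tr.
have t0 : 1 < t by case/andP: tr => *; lra.
pose P0 := Yden t + t * Ysum t; pose P1 := Yden t - Ysum t.
have P0_gt0 : 0 < P0 by apply: addr_gt0 => //; apply: mulr_gt0 => //; lra.
(* [P1 / P0] is the barycentre of the measure. A negative value there places it strictly between the
   two roots, which is what makes both weights nonnegative; the signs at -1 and 1 keep the roots in
   [-1, 1]. *)
have qm : node_poly t (P1 / P0) < 0.
  have -> : node_poly t (P1 / P0) = - (4 * Ysum t * Y0 t ^+ 3 / P0 ^+ 2).
    have : P0 != 0 by rewrite gt_eqF.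
    by rewrite /node_poly /P1 /P0 /Ysum /Yden /Y0 /Y1 /Y2 => ?; field.
  rewrite oppr_lt0; do !apply: divr_gt0 => //; last exact: exprn_gt0.
  by do ?apply: mulr_gt0 => //; exact: exprn_gt0.
have qN1 : 0 <= node_poly t (-1).
  have -> : node_poly t (-1) = (t - 1) * (t + 1) by rewrite /node_poly /Y0 /Y1 /Y2; ring.
  by apply: mulr_ge0; lra.
have q1 : 0 <= node_poly t 1.
  have -> : node_poly t 1 = Ysum t by rewrite /node_poly /Y0 /Y1 /Y2 /Ysum; ring.
  exact: ltW.
have N11 : -1 < P1 / P0 < 1.
  apply/andP; split; [rewrite ltr_pdivlMr //|rewrite ltr_pdivrMr //];
    rewrite /P1 /P0; have : 0 < (t - 1) * Ysum t by [apply: mulr_gt0 => //; lra]; lra.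
have /andP[N1m m1] := N11.
have [c1 [c2 [/andP[c1a c1b] /andP[c2a c2b] q1E q2E]]] :=
  node_poly_roots _ _ _ _ N1m m1 qN1 qm q1.
have c12 : c1 < c2 by exact: lt_trans c2a.
pose w1 := (P0 * c2 - P1) / (c2 - c1); pose w2 := (P1 - P0 * c1) / (c2 - c1).
have c12n : c2 - c1 != 0 by rewrite gt_eqF // subr_gt0.
exists c1, c2, w1, w2; split.
- by rewrite c1a ltW // (lt_trans c1b).
- by rewrite c2b ltW // (lt_trans _ c2a).
- apply: divr_ge0; last by rewrite subr_ge0 ltW.
  by rewrite subr_ge0 mulrC -ler_pdivrMr // ltW.
- apply: divr_ge0; last by rewrite subr_ge0 ltW.
  by rewrite subr_ge0 mulrC -ler_pdivlMr // ltW.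
move=> a a5 a6.
pose m k := w1 * cheb k c1 + w2 * cheb k c2.
have m0 : m 0%N = P0 by rewrite /m /w1 /w2 /=; field.
have mo1 : m 1%N = P1 by rewrite /m /w1 /w2 /=; field.
(* Since T_(j+i) + T_(j-i) = 2 T_i T_j, the combination integrates [node_poly t] times T_(k+2),
   which vanishes at both nodes. [rec0] and [rec1] are the cases k = -2 and k = -1, with T_(-j) =
   T_j. *)
have rec k : Y0 t * (m k.+4 + m k) + Y1 t * (m k.+3 + m k.+1) + Y2 t * m k.+2 = 0.
  have -> : Y0 t * (m k.+4 + m k) + Y1 t * (m k.+3 + m k.+1) + Y2 t * m k.+2 =
      w1 * (node_poly t c1 * cheb k.+2 c1) + w2 * (node_poly t c2 * cheb k.+2 c2).
    by rewrite /m !chebSS /node_poly; ring.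
  by rewrite q1E q2E !mul0r !mulr0 addr0.
have rec0 : Y0 t * (2 * m 2%N) + 2 * Y1 t * m 1%N + Y2 t * m 0%N = 0.
  have -> : Y0 t * (2 * m 2%N) + 2 * Y1 t * m 1%N + Y2 t * m 0%N =
      w1 * node_poly t c1 + w2 * node_poly t c2 by rewrite /m /node_poly /=; ring.
  by rewrite q1E q2E !mulr0 addr0.
have rec1 : Y0 t * (m 3%N + m 1%N) + Y1 t * (m 2%N + m 0%N) + Y2 t * m 1%N = 0.
  have -> : Y0 t * (m 3%N + m 1%N) + Y1 t * (m 2%N + m 0%N) + Y2 t * m 1%N =
      w1 * (node_poly t c1 * c1) + w2 * (node_poly t c2 * c2)
    by rewrite /m /node_poly /=; ring.
  by rewrite q1E q2E !mul0r !mulr0 addr0.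
have y0n : Y0 t != 0 by rewrite gt_eqF.
have solve x y : Y0 t * x = Y0 t * y -> x = y by exact: mulfI.
have m2 : m 2%N = Yden t.
  apply: solve; apply: (@mulfI _ 2%:R); first by rewrite pnatr_eq0.
  by move: rec0; rewrite m0 mo1 /P0 /P1 /Ysum /Yden /Y0 /Y1 /Y2; lra.
have m3 : m 3%N = Yden t.
  apply: solve.
  by move: rec1; rewrite m0 mo1 m2 /P0 /P1 /Ysum /Yden /Y0 /Y1 /Y2; lra.
have m4 : m 4%N = Yden t.
  apply: solve.
  by move: (rec 0%N); rewrite m0 mo1 m2 m3 /P0 /P1 /Ysum /Yden /Y0 /Y1 /Y2; lra.
have m5E : Y0 t * (m 5%N - Yden t) = - (Ysum t * (Yden t - Y0 t)).
  by move: (rec 1%N); rewrite mo1 m2 m3 m4 /P0 /P1 /Ysum /Yden /Y0 /Y1 /Y2; lra.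
have m6E : Y0 t ^+ 2 * (m 6%N - Yden t) =
    - (Ysum t * (Yden t * Y0 t - Y1 t * (Yden t - Y0 t))).
  have -> : Y0 t ^+ 2 * (m 6%N - Yden t) = Y0 t * (Y0 t * (m 6%N - Yden t)) by ring.
  have -> : Y0 t * (m 6%N - Yden t) = - (Y1 t * (m 5%N - Yden t)) - Yden t * Ysum t.
    by move: (rec 2%N); rewrite m2 m3 m4 /Ysum /Yden /Y0 /Y1 /Y2; lra.
  rewrite mulrBr mulrN mulrCA m5E; ring.
have m5 : m 5%N <= Yden t.
  rewrite -subr_le0 -(pmulr_rle0 _ y0) m5E oppr_le0.
  by apply: mulr_ge0; [exact: ltW|rewrite subr_ge0 Y0_le_Yden].
have m6 : m 6%N <= Yden t.
  rewrite -subr_le0 -(pmulr_rle0 _ (exprn_gt0 2 y0)) m6E oppr_le0.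
  by apply: mulr_ge0; [exact: ltW|rewrite subr_ge0 moment6_le].
have -> : \sum_(k < 7) a k * (w1 * cheb k c1 + w2 * cheb k c2) =
  a 0%N * m 0%N + a 1%N * m 1%N + a 2%N * m 2%N + a 3%N * m 3%N + a 4%N * m 4%N
  + a 5%N * m 5%N + a 6%N * m 6%N.
  by rewrite !big_ord_recr big_ord0 /= add0r.
rewrite !big_ord_recr big_ord0 /= add0r m0 mo1 m2 m3 m4 /P0 /P1.
(* The moments of order 0 to 4 match exactly; only the terms in [a 5] and [a 6] lose anything. *)
have := ler_wpM2l a5 m5; have := ler_wpM2l a6 m6; lra.
Qed.

Lemma sum7E (f : nat -> R) : \sum_(k < 7) f k =
  f 0%N + f 1%N + f 2%N + f 3%N + f 4%N + f 5%N + f 6%N.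
Proof. by rewrite !big_ord_recr big_ord0 /= add0r. Qed.

Lemma dual_bound t (a : nat -> R) : dual_range t ->
  (forall c, -1 <= c <= 1 -> 0 <= \sum_(k < 7) a k * cheb k c) ->
  0 <= a 5%N -> 0 <= a 6%N ->
  Ysum t * (a 1%N - t * a 0%N) <= Yden t * \sum_(k < 7) a k.
Proof.
move=> tr f0 a5 a6.
have [c1 [c2 [w1 [w2 [c1I c2I w10 w20]]]]] := dual_measure t tr.
move=> /(_ a a5 a6).
have -> : \sum_(k < 7) a k * (w1 * cheb k c1 + w2 * cheb k c2) =
    w1 * (\sum_(k < 7) a k * cheb k c1) + w2 * (\sum_(k < 7) a k * cheb k c2).
  by rewrite !mulr_sumr -big_split /=; apply: eq_bigr => k _; ring.
move/(le_trans (addr_ge0 (mulr_ge0 w10 (f0 _ c1I)) (mulr_ge0 w20 (f0 _ c2I)))).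
by rewrite subr_ge0.
Qed.

(** * The rational function W = [curve_num / curve_den] and its minimum *)

Definition curve_num t : R := 2 * (2 * t ^+ 2 + 4 * t + 1) * Ysum t.
(** This is A (s - 1) for s = t + w / A. *)
Definition curve_fac t : R := 4 * t ^+ 3 + 3 * t ^+ 2 - 6 * t + 1.
Definition curve_den t : R := (3 - t ^+ 2) * curve_fac t.
(** The numerator N' D - N D' of the derivative of W = N / D. *)
Definition crit_poly u : R := 80 * u ^+ 8 + 576 * u ^+ 7 + 1416 * u ^+ 6 + 868 * u ^+ 5
  - 1732 * u ^+ 4 - 2664 * u ^+ 3 - 568 * u ^+ 2 + 452 * u - 12.

Lemma curve_fac_gt0 t : 1 <= t -> 0 < curve_fac t.
Proof.
move=> t1.
have -> : curve_fac t = 2 + (t - 1) * (4 * t ^+ 2 + 7 * t + 1).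
  by rewrite /curve_fac; ring.
by apply: ltr_pwDl => //; apply: mulr_ge0; have := sqr_ge0 t; lra.
Qed.

Lemma curve_den_gt0 t : 1 <= t <= 13 / 10 -> 0 < curve_den t.
Proof.
move=> /andP[t1 t2]; apply: mulr_gt0; last exact: curve_fac_gt0.
have : 0 <= (13 / 10 - t) * (13 / 10 + t) by apply: mulr_ge0; lra.
lra.
Qed.

(** In e = u - 1 each claim concerns a polynomial with nonnegative coefficients. The factor 11/100 =
    119/100 - 27/25 is the most by which t can fall below u in [curve_value_min]. *)
Lemma curve_value_min_coef u : 1 <= u ->
  let k2 := 226 - 568 * u - 3996 * u ^+ 2 - 3464 * u ^+ 3 + 2170 * u ^+ 4
    + 4248 * u ^+ 5 + 2016 * u ^+ 6 + 320 * u ^+ 7 in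
  let k3 := 252 - 1224 * u - 2108 * u ^+ 2 + 1800 * u ^+ 3 + 4528 * u ^+ 4
    + 2592 * u ^+ 5 + 480 * u ^+ 6 in
  let k4 := 54 - 376 * u + 530 * u ^+ 2 + 1976 * u ^+ 3 + 1440 * u ^+ 4
    + 320 * u ^+ 5 in
  let k5 := - 8 + 32 * u + 280 * u ^+ 2 + 288 * u ^+ 3 + 80 * u ^+ 4 in
  [/\ 0 <= k3, 0 <= k5, 11 / 100 * k3 <= k2 & 11 / 100 * k5 <= k4].
Proof.
rewrite -subr_ge0 -[in X in _ -> X](subrK 1 u); move: (u - 1) => e e0.
have e2 : 0 <= e ^+ 2 by exact: exprn_ge0.
have e3 : 0 <= e ^+ 3 by exact: exprn_ge0.
have e4 : 0 <= e ^+ 4 by exact: exprn_ge0.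
have e5 : 0 <= e ^+ 5 by exact: exprn_ge0.
have e6 : 0 <= e ^+ 6 by exact: exprn_ge0.
have e7 : 0 <= e ^+ 7 by exact: exprn_ge0.
by split; lra.
Qed.

(* As a polynomial in [t - u], the difference of the two sides has linear
coefficient [crit_poly u]; the [ki] are its coefficients of degree i. *)
Lemma curve_value_min t u : dual_range t -> 1 <= u <= 119 / 100 -> crit_poly u = 0 ->
  curve_num u * curve_den t <= curve_num t * curve_den u.
Proof.
move=> /andP[t1 _] /andP[u1 u2] Pu0; rewrite -subr_ge0.
have [] := curve_value_min_coef _ u1.
set k3 := 252 - _ - _ + _ + _ + _ + _; set k5 := - 8 + _ + _ + _ + _.
set k2 := 226 - _ - _ - _ + _ + _ + _ + _; set k4 := 54 - _ + _ + _ + _ + _.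
have -> : curve_num t * curve_den u - curve_num u * curve_den t = (t - u) * crit_poly u
    + (t - u) ^+ 2 * (k2 + (t - u) * k3 + (t - u) ^+ 2 * (k4 + (t - u) * k5)).
  by rewrite /curve_num /curve_den /curve_fac /Ysum /crit_poly /k2 /k3 /k4 /k5; ring.
rewrite Pu0 mulr0 add0r.
have : - (11 / 100) <= t - u by clear Pu0 k2 k3 k4 k5; lra.
move: (t - u) k2 k3 k4 k5 => d k2 k3 k4 k5 d1 k3_ge0 k5_ge0 k23 k45.
(* As d >= -11/100, k2 + d k3 >= k2 - (11/100) k3 >= 0, and likewise for k4 + d k5. *)
have dk3 : 0 <= (d + 11 / 100) * k3 by apply: mulr_ge0; lra.
have dk5 : 0 <= (d + 11 / 100) * k5 by apply: mulr_ge0; lra.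
apply: mulr_ge0; first exact: sqr_ge0.
apply: addr_ge0; first lra.
by apply: mulr_ge0; [exact: sqr_ge0|lra].
Qed.

(** As t runs over [dual_range], s = t + w / A moves continuously from about 1.2270 to about 1.3545;
    the interval for s is chosen just inside. *)
Lemma curve_cover s : 123 / 100 <= s <= 677 / 500 ->
  exists2 t, dual_range t & Ysum t * (s - t) = Yden t.
Proof.
move=> /andP[s1 s2].
pose p : {poly R} := (4%:P * 'X ^+ 3 + 8%:P * 'X ^+ 2 + 2%:P * 'X)
  - s%:P * (5%:P * 'X ^+ 2 + 8%:P * 'X - 1%:P).
have pE t : p.[t] = (4 * t ^+ 3 + 8 * t ^+ 2 + 2 * t) - s * Ysum t.
  by rewrite /p !(hornerD, hornerN, hornerM, hornerC, hornerXn, hornerX).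
have [t tr] : exists2 t, 27 / 25 <= t <= 101 / 81 & root p t.
  by apply: poly_ivt; [lra|rewrite !pE /Ysum; apply/andP; split; lra].
rewrite rootE pE => /eqP pt; exists t => //.
by move: pt; rewrite /Ysum /Yden; lra.
Qed.

Lemma curve_value t : dual_range t ->
  curve_num t / curve_den t * (t + Yden t / Ysum t - 1) ^+ 2 =
  Ysum t * ((t + Yden t / Ysum t) * (t + Yden t / Ysum t - 1)) / Yden t.
Proof.
move=> tr; have [A0 w0 _] := dual_range_pos _ tr.
have t1 : 1 < t by case/andP: tr => *; lra.
have D0 : curve_den t != 0 by rewrite gt_eqF // curve_den_gt0 //; case/andP: tr => *; lra.
move: D0; rewrite mulf_eq0 negb_or => /andP[D1 D2].
have A1 : Ysum t != 0 by rewrite gt_eqF.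
have t2 : t != 0 by rewrite gt_eqF // (lt_trans _ t1).
have -> : t + Yden t / Ysum t - 1 = curve_fac t / Ysum t.
  by move: A1; rewrite /curve_fac /Yden /Ysum => A1; field.
have -> : t + Yden t / Ysum t = 2 * t * (2 * t ^+ 2 + 4 * t + 1) / Ysum t.
  by move: A1; rewrite /Yden /Ysum => A1; field.
by rewrite /curve_num /curve_den /Yden; field; rewrite A1 D1 D2 t2.
Qed.

Lemma curve_bound u s (a : nat -> R) : 1 <= u <= 119 / 100 -> crit_poly u = 0 ->
  123 / 100 <= s <= 677 / 500 ->
  (forall c, -1 <= c <= 1 -> 0 <= \sum_(k < 7) a k * cheb k c) ->
  0 <= a 5%N -> 0 <= a 6%N -> a 0%N = 1 -> a 1%N = s ^+ 2 ->
  curve_num u / curve_den u * (s - 1) ^+ 2 <= \sum_(k < 7) a k - 1.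
Proof.
move=> u12 Pu s12 f0 a5 a6 a0 a1.
have [t tr ts] := curve_cover _ s12.
have [A0 w0 _] := dual_range_pos _ tr.
have := dual_bound _ _ tr f0 a5 a6.
rewrite a0 a1; set S := \sum_(k < 7) a k => dual.
have Du : 0 < curve_den u by apply: curve_den_gt0; case/andP: u12 => *; lra.
have Dt : 0 < curve_den t by apply: curve_den_gt0; case/andP: tr => *; lra.
have t1 : 1 < t by case/andP: tr => *; lra.
have s1 : 0 < s - 1 by case/andP: s12 => *; lra.
have VN : curve_num u / curve_den u <= curve_num t / curve_den t.
  by rewrite ler_pdivrMr // mulrAC ler_pdivlMr // curve_value_min.
apply: (@le_trans _ _ (Ysum t * (s * (s - 1)) / Yden t)); last first.
  rewrite ler_pdivrMr //.
  (* The first term is at most w S by the dual bound and the second equals w, so the difference is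
     at most w (S - 1). *)
  have -> : Ysum t * (s * (s - 1)) = Ysum t * (s ^+ 2 - t) - Ysum t * (s - t) by ring.
  rewrite ts; lra.
apply: (le_trans (ler_wpM2r (sqr_ge0 _) VN)).
have sE : s = t + Yden t / Ysum t by rewrite -ts mulrAC divff ?gt_eqF // mul1r; ring.
by rewrite sE curve_value.
Qed.

(* Integrate f against 1 - cos over the uniform measure on the eighth roots of
unity. *)
Lemma coef1_le (a : nat -> R) :
  (forall c, -1 <= c <= 1 -> 0 <= \sum_(k < 7) a k * cheb k c) ->
  a 1%N <= 2 * a 0%N.
Proof.
move=> f0.
pose r : R := Num.sqrt (1 / 2).
have r2 : r ^+ 2 = 1 / 2 by rewrite sqr_sqrtr //; lra.
have r0 : 0 <= r by exact: sqrtr_ge0.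
have r1 : r <= 1 by rewrite -(ler_pXn2r (_ : 0 < 2)%N) ?nnegrE // r2 expr1n; lra.
(* The root of unity 1 has weight zero. Frequencies in f (1 - cos) reach only 7, so the eight-point
   average returns a_0 - a_1 / 2 without aliasing. *)
have p1 : 0 <= (1 - r) * \sum_(k < 7) a k * cheb k r.
  by apply: mulr_ge0; [lra|apply: f0; lra].
have p2 : 0 <= (1 + r) * \sum_(k < 7) a k * cheb k (- r).
  by apply: mulr_ge0; [lra|apply: f0; lra].
have p3 : 0 <= \sum_(k < 7) a k * cheb k 0 by apply: f0; lra.
have p4 : 0 <= \sum_(k < 7) a k * cheb k (-1) by apply: f0; lra.
have chr : [/\ cheb 2 r = 0, cheb 3 r = - r, cheb 4 r = -1, cheb 5 r = - r
    & cheb 6 r = 0].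
  have c2 : cheb 2 r = 0 by rewrite /=; lra.
  have c3 : cheb 3 r = - r by rewrite chebSS c2 /=; ring.
  have c4 : cheb 4 r = - 1 by rewrite chebSS c3 c2 /=; lra.
  have c5 : cheb 5 r = - r by rewrite chebSS c4 c3 /=; ring.
  by split => //; rewrite chebSS c5 c4; lra.
have chN : [/\ cheb 2 (- r) = 0, cheb 3 (- r) = r, cheb 4 (- r) = -1,
    cheb 5 (- r) = r & cheb 6 (- r) = 0].
  have c2 : cheb 2 (- r) = 0 by rewrite /=; lra.
  have c3 : cheb 3 (- r) = r by rewrite chebSS c2 /=; ring.
  have c4 : cheb 4 (- r) = - 1 by rewrite chebSS c3 c2 /=; lra.
  have c5 : cheb 5 (- r) = r by rewrite chebSS c4 c3 /=; ring.
  by split => //; rewrite chebSS c5 c4; lra.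
have chs c : \sum_(k < 7) a k * cheb k c = a 0%N + a 1%N * c + a 2%N * cheb 2 c
    + a 3%N * cheb 3 c + a 4%N * cheb 4 c + a 5%N * cheb 5 c + a 6%N * cheb 6 c.
  by rewrite (sum7E (fun k => a k * cheb k c)) mulr1.
move: p1 p2 p3 p4; rewrite !chs.
case: chr => -> -> -> -> ->; case: chN => -> -> -> -> ->.
have rE k : a k * r ^+ 2 = a k / 2 by rewrite r2 mul1r.
move: (rE 1%N) (rE 3%N) (rE 5%N) => /= E1 E3 E5 p1 p2 p3 p4.
by clear - p1 p2 p3 p4 E1 E3 E5; lra.
Qed.

(** For s <= 6/5 the crude bound S >= a_0 + a_1 suffices. Otherwise t is frozen at the nearer end of
    [dual_range]. Each time the slack is a concave quadratic in s, so the product of the distances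
    to the ends of the interval reduces it to a linear inequality. *)
Lemma off_curve_bound s (a : nat -> R) (v : R) : v <= 349 / 10 -> 1 < s ->
  ~~ (123 / 100 <= s <= 677 / 500) ->
  (forall c, -1 <= c <= 1 -> 0 <= \sum_(k < 7) a k * cheb k c) ->
  (forall k, (k < 7)%N -> 0 <= a k) -> a 0%N = 1 -> a 1%N = s ^+ 2 ->
  v * (s - 1) ^+ 2 <= \sum_(k < 7) a k - 1.
Proof.
move=> vle s1 s12 f0 ak a0 a1.
have a5 : 0 <= a 5%N by exact: ak.
have a6 : 0 <= a 6%N by exact: ak.
apply: le_trans (ler_wpM2r (sqr_ge0 _) vle) _.
set S := \sum_(k < 7) a k.
have [s2|s2] := leP s (6 / 5).
  have S1 : 1 + s ^+ 2 <= S.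
    have [a2 a3 a4] : [/\ 0 <= a 2%N, 0 <= a 3%N & 0 <= a 4%N] by split; exact: ak.
    by rewrite /S (sum7E a) a0 a1; clear - a2 a3 a4 a5 a6; lra.
  have : 0 <= (6 / 5 - s) * (s - 1) by clear - s1 s2; apply: mulr_ge0; lra.
  by clear - S1 s1 s2; lra.
have [s3|s3] := ltP s (123 / 100).
  have tr : dual_range (27 / 25 : R).
    by clear; rewrite /dual_range; apply/andP; split; lra.
  have := dual_bound _ _ tr f0 a5 a6.
  rewrite -/S a0 a1 /Ysum /Yden => d.
  have : 0 <= (s - 6 / 5) * (123 / 100 - s).
    by clear - s2 s3; apply: mulr_ge0; lra.
  by clear - d s2 s3; lra.
have s4 : 677 / 500 < s by rewrite ltNge; apply: contra s12 => s4; rewrite s3.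
(* 177/125 is slightly above the square root of 2, the limit set by [coef1_le]. *)
have s5 : s <= 177 / 125.
  rewrite leNgt; apply/negP => s6; have := coef1_le _ f0; rewrite a0 a1 => s2le.
  have : 0 < (s - 177 / 125) * (s + 177 / 125).
    by clear - s1 s6; apply: mulr_gt0; lra.
  by clear - s2le; lra.
have tr : dual_range (101 / 81 : R).
  by clear; rewrite /dual_range; apply/andP; split; lra.
have := dual_bound _ _ tr f0 a5 a6.
rewrite -/S a0 a1 /Ysum /Yden => d.
have : 0 <= (s - 677 / 500) * (177 / 125 - s).
  by clear - s4 s5; apply: mulr_ge0; lra.
by clear - d s4 s5; lra.
Qed.
End DualFamily.

(* [d] appended as decimal digits to [x].  It evaluates the literals of [dec7] in
the ring: as unary naturals they are too large to be computed. *)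
Fixpoint dec_val {R : pzSemiRingType} (d : Decimal.uint) (x : R) : R :=
  match d with
  | Decimal.Nil => x
  | Decimal.D0 d => dec_val d (10 * x)
  | Decimal.D1 d => dec_val d (10 * x + 1)
  | Decimal.D2 d => dec_val d (10 * x + 2)
  | Decimal.D3 d => dec_val d (10 * x + 3)
  | Decimal.D4 d => dec_val d (10 * x + 4)
  | Decimal.D5 d => dec_val d (10 * x + 5)
  | Decimal.D6 d => dec_val d (10 * x + 6)
  | Decimal.D7 d => dec_val d (10 * x + 7)
  | Decimal.D8 d => dec_val d (10 * x + 8)
  | Decimal.D9 d => dec_val d (10 * x + 9)
  end.

(** [Nat.of_uint] is tail recursive, so the induction runs with a general accumulator. *)
Lemma natr_of_uint (R : pzSemiRingType) d : (Nat.of_uint d)%:R = dec_val d 0 :> R.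
Proof.
rewrite /Nat.of_uint -[0]/(0%:R).
elim: d 0%N => //= d IH n; rewrite IH PeanoNat.Nat.tail_mul_spec multE; congr dec_val;
  (have E k : (k + 10 * n)%N%:R = 10 * n%:R + k%:R :> R by rewrite addrC natrD natrM);
  by [rewrite (E 0%N) addr0|exact: (E 1%N)|exact: (E 2%N)|exact: (E 3%N)|exact: (E 4%N)
    |exact: (E 5%N)|exact: (E 6%N)|exact: (E 7%N)|exact: (E 8%N)|exact: (E 9%N)].
Qed.

Lemma dec7E (R : realType) d :
  dec7 (Nat.of_num_uint (Number.UIntDecimal d)) = dec_val d 0 / 10 ^+ 7 :> R.
Proof. by rewrite /dec7 -natr_of_uint. Qed.

(** * Enclosure of the critical point and seven-digit numerics *)

Section Numerics.
Context {R : realType}.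
Implicit Types (t u c s : R).

(** The enclosure is 1.1834456195 <= u <= 1.1834456196, written two digits at a time to keep the
    numerals small. *)
Definition crit_lo : R := 1 + 18 / 10 ^+ 2 + 34 / 10 ^+ 4 + 45 / 10 ^+ 6
  + 61 / 10 ^+ 8 + 95 / 10 ^+ 10.
Definition crit_hi : R := 1 + 18 / 10 ^+ 2 + 34 / 10 ^+ 4 + 45 / 10 ^+ 6
  + 61 / 10 ^+ 8 + 96 / 10 ^+ 10.
Definition Ynorm2 t : R := 5 * t ^+ 4 + 16 * t ^+ 3 + 12 * t ^+ 2 + 3.

Lemma crit_poly_root : exists2 u : R, crit_lo <= u <= crit_hi & crit_poly u = 0.
Proof.
pose p : {poly R} := 80%:P * 'X ^+ 8 + 576%:P * 'X ^+ 7 + 1416%:P * 'X ^+ 6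
  + 868%:P * 'X ^+ 5 - 1732%:P * 'X ^+ 4 - 2664%:P * 'X ^+ 3 - 568%:P * 'X ^+ 2
  + 452%:P * 'X - 12%:P.
have pE t : p.[t] = crit_poly t.
  by rewrite /p !(hornerD, hornerN, hornerM, hornerC, hornerXn, hornerX).
have [u ur] : exists2 u, crit_lo <= u <= crit_hi & root p u.
  apply: poly_ivt; first by rewrite /crit_lo /crit_hi; lra.
  by rewrite !pE /crit_poly /crit_lo /crit_hi; apply/andP; split; lra.
by rewrite rootE pE => /eqP; exists u.
Qed.

(** With each power of u boxed separately, the decimal checks become linear in u, ..., u^5 and fall
    to [lra]. *)
Lemma crit_powers u : crit_lo <= u <= crit_hi ->
  [/\ crit_lo ^+ 2 <= u ^+ 2 <= crit_hi ^+ 2, crit_lo ^+ 3 <= u ^+ 3 <= crit_hi ^+ 3,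
      crit_lo ^+ 4 <= u ^+ 4 <= crit_hi ^+ 4 & crit_lo ^+ 5 <= u ^+ 5 <= crit_hi ^+ 5].
Proof.
have u0 : 0 <= crit_lo by rewrite /crit_lo; lra.
move=> /andP[u1 u2]; have u3 := le_trans u0 u1; have u4 := le_trans u3 u2.
by split; rewrite !ler_pXn2r ?nnegrE // u1.
Qed.

Lemma eq7_div (d N D : R) : 0 < D -> (d - dec7 1) * D < N -> N < (d + dec7 1) * D ->
  eq7 (N / D) d.
Proof.
move=> D0 N1 N2; rewrite /eq7 ltr_distl.
by rewrite ltr_pdivlMr // N1 ltr_pdivrMr.
Qed.

(** Squaring removes the radical; [dec7 1 <= d] keeps the lower end nonnegative, so that squaring
    preserves the order. *)
Lemma eq7_sqrt (d N D : R) : 0 < D -> 0 <= N -> dec7 1 <= d ->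
  (d - dec7 1) ^+ 2 * D < N ^+ 2 -> N ^+ 2 < (d + dec7 1) ^+ 2 * D ->
  eq7 (N / Num.sqrt D) d.
Proof.
move=> D0 N0 d1 N1 N2.
have dec0 : 0 <= dec7 1 :> R by apply: divr_ge0; rewrite ?exprn_ge0.
have sD : 0 < Num.sqrt D by rewrite sqrtr_gt0.
apply: eq7_div => //.
- rewrite -(ltr_pXn2r (_ : 0 < 2)%N) ?nnegrE ?mulr_ge0 ?subr_ge0 ?(ltW sD) //.
  by rewrite exprMn sqr_sqrtr // ltW.
- rewrite -(ltr_pXn2r (_ : 0 < 2)%N) ?nnegrE ?mulr_ge0 ?addr_ge0 ?(ltW sD)
    ?(le_trans _ d1) //.
  by rewrite exprMn sqr_sqrtr // ltW.
Qed.

Lemma curve_value_eq7 u : crit_lo <= u <= crit_hi ->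
  eq7 (curve_num u / curve_den u) (dec7 348992259).
Proof.
move=> ur; have [/andP[a2 b2] /andP[a3 b3] /andP[a4 b4] /andP[a5 b5]] := crit_powers _ ur.
case/andP: ur a2 b2 a3 b3 a4 b4 a5 b5; rewrite /crit_lo /crit_hi =>
  a1 b1 a2 b2 a3 b3 a4 b4 a5 b5.
rewrite dec7E /dec_val; apply: eq7_div; first by apply: curve_den_gt0; clear - a1 b1; lra.
- by rewrite /curve_num /curve_den /curve_fac /Ysum /dec7; lra.
- by rewrite /curve_num /curve_den /curve_fac /Ysum /dec7; lra.
Qed.
End Numerics.

(** * From cosine polynomials and points of R^7 to the Chebyshev bounds *)

Section Trig.
Context {R : realType}.
Implicit Types (a x : 'rV[R]_7).

Lemma cos_cheb k (phi : R) : cos (k%:R * phi) = cheb k (cos phi).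
Proof.
suff [] : cos (k%:R * phi) = cheb k (cos phi) /\
  cos (k.+1%:R * phi) = cheb k.+1 (cos phi) by [].
elim: k => [|k [IH0 IH1]]; first by rewrite mul0r cos0 mul1r.
split => //; rewrite chebSS -IH0 -IH1.
have -> : k.+2%:R * phi = k.+1%:R * phi + phi by rewrite -natr1 mulrDl mul1r.
have -> : k%:R * phi = k.+1%:R * phi - phi by rewrite -natr1 mulrDl mul1r addrK.
by rewrite cosD cosB; ring.
Qed.

Lemma cospoly_ge0_cheb a : (forall phi, 0 <= cospoly a phi) ->
  forall c, -1 <= c <= 1 -> 0 <= \sum_(k < 7) entry a k * cheb k c.
Proof.
move=> a0 c c1; apply: le_trans (a0 (acos c)) _; rewrite le_eqVlt; apply/orP; left.
by apply/eqP/eq_bigr => k _; rewrite cos_cheb acosK // in_itv.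
Qed.

Lemma cospoly0 a : cospoly a 0 = \sum_(k < 7) entry a k.
Proof. by apply: eq_bigr => k _; rewrite mulr0 cos0 mulr1. Qed.

Lemma cospoly_sqmod_ge0 x phi : 0 <= cospoly (sqmod_coef x) phi.
Proof. by rewrite cospoly_sqmod sqr_ge0. Qed.

Lemma sqmod_coef0 x : entry (sqmod_coef x) 0 = \sum_(k < 7) entry x k ^+ 2.
Proof. by rewrite {1}/entry mxE inordK. Qed.

Lemma sqmod_coefE x j : (0 < j < 7)%N ->
  entry (sqmod_coef x) j = 2 * \sum_(k < 7 - j) entry x k * entry x (k + j).
Proof. by case: j => // j j7; rewrite {1}/entry mxE inordK. Qed.

(** Evaluation of the squared modulus at phi = 0; it makes [F2 x] equal to f(0) - 1. *)
Lemma sum_sqmod_coef x :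
  \sum_(k < 7) entry (sqmod_coef x) k = (\sum_(k < 7) entry x k) ^+ 2.
Proof.
rewrite (sum7E (entry (sqmod_coef x))) (sum7E (entry x)) sqmod_coef0.
rewrite !sqmod_coefE // (sum7E (fun k => entry x k ^+ 2)).
by rewrite !big_ord_recr !big_ord0 /= !add0r; ring.
Qed.

Lemma feasible2_coef (b : R) x : feasible2 b x -> [/\ entry (sqmod_coef x) 0 = 1,
  entry (sqmod_coef x) 1 = b, 0 <= entry (sqmod_coef x) 5
  & 0 <= entry (sqmod_coef x) 6].
Proof.
case=> x0 x1 x5 x6; split.
- by rewrite sqmod_coef0.
- by rewrite sqmod_coefE // -x1; under eq_bigr do rewrite addn1.
- by rewrite sqmod_coefE // !big_ord_recr big_ord0 /= add0r.
- by rewrite sqmod_coefE // !big_ord_recr big_ord0 /= add0r.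
Qed.

Lemma crit_range (u : R) : crit_lo <= u <= crit_hi -> 1 <= u <= 119 / 100.
Proof. by rewrite /crit_lo /crit_hi => /andP[? ?]; apply/andP; split; lra. Qed.

Lemma F2_lower u s x : crit_lo <= u <= crit_hi -> crit_poly u = 0 ->
  123 / 100 <= s <= 677 / 500 ->
  feasible2 (s ^+ 2) x -> curve_num u / curve_den u * (s - 1) ^+ 2 <= F2 x.
Proof.
move=> ur u0 sr /feasible2_coef[x0 x1 x5 x6].
rewrite /F2 -sum_sqmod_coef.
apply: (curve_bound u s (entry (sqmod_coef x))) => //; first exact: crit_range.
by apply: cospoly_ge0_cheb => phi; exact: cospoly_sqmod_ge0.
Qed.

Lemma curve_value_le (u : R) : crit_lo <= u <= crit_hi ->
  curve_num u / curve_den u <= 349 / 10.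
Proof.
move=> /curve_value_eq7; rewrite dec7E /dec_val /eq7 ltr_distl /dec7.
by move: (curve_num u / curve_den u) => v /andP[_ ?]; lra.
Qed.

(** v is invariant under scaling f, so f is divided by a_0 and s is the square root of a_1 / a_0. *)
Lemma vratio_lower u (f : 'rV[R]_7) : crit_lo <= u <= crit_hi -> crit_poly u = 0 ->
  cosC R 6 f -> curve_num u / curve_den u <= vratio f.
Proof.
move=> ur u0 [fk /andP[f0 f01] fpos].
have f0n : entry f 0 != 0 by rewrite gt_eqF.
have f1 : 0 < entry f 1 by exact: lt_trans f01.
pose b k := entry f k / entry f 0.
pose s := Num.sqrt (b 1%N).
have b1 : 1 < b 1%N by rewrite /b ltr_pdivlMr // mul1r.
have s2 : s ^+ 2 = b 1%N by rewrite sqr_sqrtr // ltW // (lt_trans _ b1).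
have s1 : 1 < s by rewrite -(sqrtr1 R) ltr_sqrt // (lt_trans _ b1).
have bk k : (k < 7)%N -> 0 <= b k.
  by move=> k7; apply: divr_ge0; [have := fk (Ordinal k7)|exact: ltW].
have sumb c : \sum_(k < 7) b k * cheb k c =
    (\sum_(k < 7) entry f k * cheb k c) / entry f 0.
  by rewrite mulr_suml; apply: eq_bigr => k _; rewrite mulrAC.
have bpos c : -1 <= c <= 1 -> 0 <= \sum_(k < 7) b k * cheb k c.
  by move=> c1; rewrite sumb divr_ge0 ?(ltW f0) // cospoly_ge0_cheb.
have b0 : b 0%N = 1 by rewrite /b divff.
have low : curve_num u / curve_den u * (s - 1) ^+ 2 <= \sum_(k < 7) b k - 1.
  have [sr|sr] := boolP (123 / 100 <= s <= 677 / 500).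
    by apply: curve_bound => //; [exact: crit_range|exact: bk|exact: bk].
  by apply: off_curve_bound => //; exact: curve_value_le.
rewrite /vratio cospoly0.
have -> : Num.sqrt (entry f 1) = s * Num.sqrt (entry f 0).
  by rewrite -sqrtrM ?bk // /b divfK.
rewrite -{2}(mul1r (Num.sqrt _)) -mulrBl exprMn sqr_sqrtr ?(ltW f0) //.
rewrite ler_pdivlMr; last by rewrite mulr_gt0 // exprn_gt0 // subr_gt0.
rewrite mulrA; have -> : \sum_(k < 7) entry f k - entry f 0 =
    (\sum_(k < 7) b k - 1) * entry f 0.
  rewrite mulrBl mul1r mulr_suml; congr (_ - _).
  by apply: eq_bigr => k _; rewrite divfK.
by rewrite ler_wpM2r // ltW.
Qed.
End Trig.

Lemma inf_min (R : realType) (S : set R) v :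
  S v -> (forall y, S y -> v <= y) -> inf S = v.
Proof.
move=> Sv vS; apply/eqP; rewrite eq_le; apply/andP; split.
  by apply: ge_inf => //; exists v.
by apply: lb_le_inf => //; exists v.
Qed.

(** * The extremal point and its value *)

Section Primal.
Context {R : realType}.
Implicit Types (v : seq R) (u : R).

Definition unit_row v : 'rV[R]_7 :=
  \row_(i < 7) (v`_i / Num.sqrt (\sum_(k < 7) v`_k ^+ 2)).

Lemma entry_unit_row v k : (k < 7)%N ->
  entry (unit_row v) k = v`_k / Num.sqrt (\sum_(k < 7) v`_k ^+ 2).
Proof. by move=> k7; rewrite /entry mxE inordK. Qed.

Lemma entryM_unit_row v j k : (j < 7)%N -> (k < 7)%N ->
  entry (unit_row v) j * entry (unit_row v) k =
  v`_j * v`_k / (\sum_(i < 7) v`_i ^+ 2).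
Proof.
move=> j7 k7; rewrite !entry_unit_row // mulf_div -expr2 sqr_sqrtr //.
by apply: sumr_ge0 => i _; exact: sqr_ge0.
Qed.

Lemma sqmod_unit_row0 v : 0 < \sum_(k < 7) v`_k ^+ 2 ->
  entry (sqmod_coef (unit_row v)) 0 = 1.
Proof.
move=> v0; rewrite sqmod_coef0.
under eq_bigr do rewrite expr2 entryM_unit_row //.
by rewrite -mulr_suml divff // gt_eqF.
Qed.

Lemma sqmod_unit_row v j : (0 < j < 7)%N -> entry (sqmod_coef (unit_row v)) j =
  2 * (\sum_(k < 7 - j) v`_k * v`_(k + j)) / \sum_(k < 7) v`_k ^+ 2.
Proof.
move=> j7; rewrite sqmod_coefE // -mulrA mulr_suml; congr (2 * _).
case/andP: j7 => j0 j7; apply: eq_bigr => k _; have := ltn_ord k.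
rewrite ltn_subRL => kj; rewrite entryM_unit_row //; last by rewrite addnC.
by apply: leq_ltn_trans kj; rewrite leq_addl.
Qed.

(** Without feasible points [r2 b] would be the conventional 0, and the lower bound on [ratio2 b]
    would fail. *)
Lemma feasible2_nonempty (b : R) : 0 <= b <= 184 / 100 -> feasible2 b !=set0.
Proof.
move=> /andP[b0 b1].
(* The vector [v] below is e_0 at w = 0; at w = 1 it is close to the top
eigenvector of the path, with Rayleigh quotient 212 / 115 > 1.84. *)
pose p : {poly R} := 8%:P * 'X + 204%:P * 'X ^+ 2
  - b%:P * (1%:P + 2%:P * 'X + 112%:P * 'X ^+ 2).
have pE c : p.[c] = 8 * c + 204 * c ^+ 2 - b * (1 + 2 * c + 112 * c ^+ 2).
  by rewrite /p !(hornerD, hornerN, hornerM, hornerC, hornerXn, hornerX).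
have [w /andP[w0 w1]] : exists2 w, 0 <= w <= 1 & root p w.
  by apply: poly_ivt; [lra|rewrite !pE; apply/andP; split; lra].
rewrite rootE pE => /eqP pw0.
pose v := [:: 1 + w; 4 * w; 5 * w; 5 * w; 5 * w; 4 * w; 2 * w].
have vE : \sum_(k < 7) v`_k ^+ 2 = 1 + 2 * w + 112 * w ^+ 2.
  by rewrite (sum7E (fun k => v`_k ^+ 2)) /=; ring.
have w2 : 0 <= w ^+ 2 by exact: sqr_ge0.
have v0 : 0 < \sum_(k < 7) v`_k ^+ 2 by rewrite vE; lra.
exists (unit_row v); split.
- by rewrite -sqmod_coef0 sqmod_unit_row0.
- transitivity (entry (sqmod_coef (unit_row v)) 1).
    by rewrite sqmod_coefE //; under [in RHS]eq_bigr do rewrite addn1.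
  rewrite sqmod_unit_row // vE !big_ord_recr big_ord0 /= add0r.
  have D0 : 1 + 2 * w + 112 * w ^+ 2 != 0 by rewrite -vE gt_eqF.
  by apply: (mulIf D0); rewrite divfK //; lra.
- rewrite !entryM_unit_row // -mulrDl /=.
  by do !apply: mulr_ge0; rewrite ?invr_ge0 ?(ltW v0) // addr_ge0 // !mulr_ge0 //; lra.
- rewrite entryM_unit_row //=.
  by do !apply: mulr_ge0; rewrite ?invr_ge0 ?(ltW v0) //; lra.
Qed.

(** The two final zeros force a_5 = a_6 = 0, so the terms lost in the dual bound vanish. *)
Definition opt_seq u : seq R := [:: Y0 u; Y1 u; Y2 u; Y1 u; Y0 u; 0; 0].
Definition opt_row u := unit_row (opt_seq u).

Lemma opt_seq_sumsq u : \sum_(k < 7) (opt_seq u)`_k ^+ 2 = Ynorm2 u.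
Proof.
by rewrite (sum7E (fun k => (opt_seq u)`_k ^+ 2)) /= /Ynorm2 /Y0 /Y1 /Y2; ring.
Qed.

Lemma Ynorm2_gt0 u : 1 <= u -> 0 < Ynorm2 u.
Proof.
move=> u1; apply: ltr_wpDl => //; have u0 : 0 <= u by lra.
by rewrite !addr_ge0 // mulr_ge0 // exprn_ge0.
Qed.

(** After cross-multiplication the two sides differ by -u^2 times [crit_poly u]: criticality of W is
    the compatibility of a_1 with s = u + w / A. *)
Lemma opt_coef1 u : 1 <= u <= 119 / 100 -> crit_poly u = 0 ->
  entry (sqmod_coef (opt_row u)) 1 = (u + Yden u / Ysum u) ^+ 2.
Proof.
move=> /andP[u1 u2] Pu; have n0 := Ynorm2_gt0 _ u1.
have A0 : 0 < Ysum u by have := sqr_ge0 u; rewrite /Ysum; clear Pu; lra.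
rewrite sqmod_unit_row // opt_seq_sumsq !big_ord_recr big_ord0 /= add0r !mulr0 !addr0.
have -> : u + Yden u / Ysum u = (u * Ysum u + Yden u) / Ysum u.
  by rewrite mulrDl mulfK // gt_eqF.
have nn : Ynorm2 u != 0 by rewrite gt_eqF.
have An : Ysum u ^+ 2 != 0 by rewrite gt_eqF // exprn_gt0.
rewrite expr_div_n; apply/eqP; rewrite eqr_div //.
rewrite -subr_eq0; apply/eqP; transitivity (- u ^+ 2 * crit_poly u).
  by rewrite /Ynorm2 /Yden /Ysum /Y0 /Y1 /Y2 /crit_poly; ring.
by rewrite Pu mulr0.
Qed.

Lemma F2_opt_row u : 27 / 25 <= u <= 119 / 100 -> crit_poly u = 0 ->
  F2 (opt_row u) = curve_num u / curve_den u * (u + Yden u / Ysum u - 1) ^+ 2.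
Proof.
move=> ur Pu.
have ur1 : 1 <= u <= 119 / 100 by clear Pu; lra.
have tr : dual_range u by rewrite /dual_range; clear Pu; lra.
have [A0 w0 _] := dual_range_pos _ tr.
rewrite curve_value // /F2.
have n0 : 0 < Ynorm2 u by apply: Ynorm2_gt0; case/andP: ur1.
have -> : \sum_(i < 7) entry (opt_row u) i = Ysum u / Num.sqrt (Ynorm2 u).
  under eq_bigr do rewrite entry_unit_row //.
  rewrite opt_seq_sumsq -mulr_suml (sum7E (fun k => (opt_seq u)`_k)) /=; congr (_ / _).
  by rewrite /Y0 /Y1 /Y2 /Ysum; ring.
rewrite expr_div_n sqr_sqrtr ?(ltW n0) //.
have := opt_coef1 _ ur1 Pu.
rewrite sqmod_unit_row // opt_seq_sumsq !big_ord_recr big_ord0 /= add0r !mulr0 !addr0.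
set s := u + _ => sE.
have ws : Yden u = Ysum u * (s - u).
  by rewrite /s addrAC subrr add0r mulrC divfK // gt_eqF.
(* The equation (Adj - u) y = w 1 paired with y, where y.Adj y = a_1 |y|^2 and a_1 = s^2. *)
have : Ynorm2 u * s ^+ 2 = Ynorm2 u * u + Yden u * Ysum u.
  rewrite -sE mulrC divfK ?gt_eqF //.
  by rewrite /Ynorm2 /Yden /Ysum /Y0 /Y1 /Y2; ring.
move/eqP; rewrite -subr_eq0 => /eqP nE.
apply/eqP; rewrite -subr_eq0; apply/eqP.
have nn : Ynorm2 u != 0 by rewrite gt_eqF.
have wn : Yden u != 0 by rewrite gt_eqF.
have -> : Ysum u ^+ 2 / Ynorm2 u - 1 - Ysum u * (s * (s - 1)) / Yden u =
  - (Ysum u * (Ynorm2 u * s ^+ 2 - (Ynorm2 u * u + Yden u * Ysum u))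
      + Ynorm2 u * (Yden u - Ysum u * (s - u))) / (Ynorm2 u * Yden u).
  by field; rewrite nn wn.
by rewrite nE {1}ws subrr !mulr0 addr0 oppr0 mul0r.
Qed.

Lemma opt_entries u : crit_lo <= u <= crit_hi ->
  [/\ eq7 (entry (opt_row u) 0) (dec7 2114174), eq7 (entry (opt_row u) 1) (dec7 5028451),
      eq7 (entry (opt_row u) 2) (dec7 6363167), eq7 (entry (opt_row u) 3) (dec7 5028452)
    & eq7 (entry (opt_row u) 4) (dec7 2114174)].
Proof.
move=> ur.
have /andP[u0 _] := crit_range _ ur.
have n0 := Ynorm2_gt0 _ u0.
have [/andP[a2 b2] /andP[a3 b3] /andP[a4 b4] _] := crit_powers _ ur.
case/andP: ur a2 b2 a3 b3 a4 b4; rewrite /crit_lo /crit_hi => a1 b1 a2 b2 a3 b3 a4 b4.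
have [y0 y1 y2] : [/\ 0 <= Y0 u, 0 <= Y1 u & 0 <= Y2 u].
  have := sqr_ge0 u; rewrite /Y0 /Y1 /Y2; clear - u0 a2; split; lra.
split; rewrite dec7E /dec_val entry_unit_row // opt_seq_sumsq /=;
  (apply: eq7_sqrt => //; rewrite /dec7 /Ynorm2 ?/Y0 ?/Y1 ?/Y2; [by clear; lra| |];
  by clear - a1 b1 a2 b2 a3 b3 a4 b4; lra).
Qed.

Lemma opt_coefs u : crit_lo <= u <= crit_hi -> let f := sqmod_coef (opt_row u) in
  [/\ eq7 (entry f 1) (dec7 17051159), eq7 (entry f 2) (dec7 10438202),
      eq7 (entry f 3) (dec7 4252409) & eq7 (entry f 4) (dec7 893946)].
Proof.
move=> ur f; rewrite /f.
have /andP[u0 _] := crit_range _ ur.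
have n0 := Ynorm2_gt0 _ u0.
have [/andP[a2 b2] /andP[a3 b3] /andP[a4 b4] _] := crit_powers _ ur.
case/andP: ur a2 b2 a3 b3 a4 b4; rewrite /crit_lo /crit_hi => a1 b1 a2 b2 a3 b3 a4 b4.
split; rewrite dec7E /dec_val sqmod_unit_row // opt_seq_sumsq !big_ord_recr !big_ord0 /=;
  apply: eq7_div => //; rewrite /dec7 /Ynorm2 ?/Y0 ?/Y1 ?/Y2;
  by clear - a1 b1 a2 b2 a3 b3 a4 b4; lra.
Qed.
End Primal.

(** * Bounds on the interval of a_1, and admissibility of the extremal point *)

Section Assembly.
Context {R : realType}.
Implicit Types (u s b : R).

(** The square roots, about 1.283 to 1.350, stay within the range of [curve_cover]; hence r_2 needs
    only the curve bound, and other values of s arise only for C_6. *)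
Lemma dec7_interval_range b : dec7 16456659 <= b <= dec7 18231801 ->
  1 < b <= 184 / 100 /\ 123 / 100 <= Num.sqrt b <= 677 / 500.
Proof.
case/andP => b1 b2; move: b1; rewrite dec7E /dec_val => b1.
move: b2; rewrite dec7E /dec_val => b2; split; first by apply/andP; split; lra.
have s0 : 0 <= Num.sqrt b by exact: sqrtr_ge0.
have s2 : Num.sqrt b ^+ 2 = b by rewrite sqr_sqrtr //; lra.
move: (Num.sqrt b) s0 s2 => s s0 s2.
apply/andP; split; rewrite leNgt; apply/negP => sb.
  have : 0 < (123 / 100 - s) * (123 / 100 + s).
    by clear - s0 sb; apply: mulr_gt0; lra.
  by clear - b1 s2; lra.
have : 0 < (s - 677 / 500) * (s + 677 / 500).
  by clear - s0 sb; apply: mulr_gt0; lra.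
by clear - b2 s2; lra.
Qed.

Lemma opt_coef1_range u : crit_lo <= u <= crit_hi ->
  dec7 16456659 <= entry (sqmod_coef (opt_row u)) 1 <= dec7 18231801.
Proof.
move=> /opt_coefs[bE _ _ _]; move: (entry _ 1) bE => b bE.
rewrite dec7E /dec_val /eq7 ltr_distl /dec7 in bE; case/andP: bE => b1 b2.
by apply/andP; split; rewrite dec7E /dec_val; lra.
Qed.

Lemma ratio2_lower u b : crit_lo <= u <= crit_hi -> crit_poly u = 0 ->
  dec7 16456659 <= b <= dec7 18231801 -> curve_num u / curve_den u <= ratio2 b.
Proof.
move=> ur Pu /dec7_interval_range[/andP[b1 b2] sr].
rewrite /ratio2; have [|x xF [<- _]] := @r2_attained _ b.
  by apply: feasible2_nonempty; rewrite b2 ltW // (lt_trans _ b1).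
have bE : b = Num.sqrt b ^+ 2 by rewrite sqr_sqrtr // ltW // (lt_trans _ b1).
rewrite ler_pdivlMr; first by apply: F2_lower; rewrite // -bE.
by rewrite exprn_gt0 // subr_gt0 -(sqrtr1 R) ltr_sqrt // (lt_trans _ b1).
Qed.

Lemma opt_feasible2 u : crit_lo <= u <= crit_hi ->
  feasible2 (entry (sqmod_coef (opt_row u)) 1) (opt_row u).
Proof.
move=> ur; have /andP[u1 _] := crit_range _ ur.
have n0 := Ynorm2_gt0 _ u1.
split.
- by rewrite -sqmod_coef0 sqmod_unit_row0 // opt_seq_sumsq.
- by rewrite sqmod_coefE //; under [in RHS]eq_bigr do rewrite addn1.
- by rewrite !entryM_unit_row //= !(mulr0, mul0r, addr0).
- by rewrite !entryM_unit_row //= !(mulr0, mul0r, addr0).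
Qed.

Lemma opt_coef56 u : entry (sqmod_coef (opt_row u)) 5 = 0 /\
  entry (sqmod_coef (opt_row u)) 6 = 0.
Proof.
by rewrite !sqmod_unit_row // !big_ord_recr !big_ord0 /= !(mulr0, mul0r, addr0).
Qed.

Lemma opt_cosC u : crit_lo <= u <= crit_hi -> cosC R 6 (sqmod_coef (opt_row u)).
Proof.
move=> ur; have /andP[u1 _] := crit_range _ ur.
have n0 := Ynorm2_gt0 _ u1.
have f0 : entry (sqmod_coef (opt_row u)) 0 = 1.
  by rewrite sqmod_unit_row0 // opt_seq_sumsq.
(* Nonnegative entries make every coefficient of the squared modulus nonnegative; indices past the
   list give the default 0. *)
have v0 k : 0 <= (opt_seq u)`_k.
  have [y0 y1 y2] : [/\ 0 <= Y0 u, 0 <= Y1 u & 0 <= Y2 u].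
    have u2 := sqr_ge0 u; rewrite /Y0 /Y1 /Y2; clear - u1 u2.
    by split; lra.
  by do 7?case: k => [|k] //=; rewrite nth_nil.
split.
- move=> [[|k] kn] /=; first by rewrite f0.
  rewrite sqmod_unit_row // opt_seq_sumsq divr_ge0 ?(ltW n0) // mulr_ge0 //.
  by apply: sumr_ge0 => i _; rewrite mulr_ge0 ?v0.
- rewrite f0 ltr01 /=.
  by have [/andP[]] := dec7_interval_range _ (opt_coef1_range _ ur).
- by move=> phi; exact: cospoly_sqmod_ge0.
Qed.
End Assembly.

Theorem theorem6p2 (R : realType) :
  let I : set R := [set a | dec7 16456659 <= a <= dec7 18231801] in
  [/\ cosV R 6 = inf (ratio2 @` I),
      eq7 (cosV R 6) (dec7 348992259)
    & exists x : 'rV[R]_7,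
      let f := sqmod_coef x in
      let a := entry f 1 in
      [/\ [/\ eq7 (entry x 0) (dec7 2114174), eq7 (entry x 1) (dec7 5028451),
              eq7 (entry x 2) (dec7 6363167), eq7 (entry x 3) (dec7 5028452)
            & [/\ eq7 (entry x 4) (dec7 2114174), entry x 5 = 0
                & entry x 6 = 0]],
          [/\ entry f 0 = 1, eq7 (entry f 1) (dec7 17051159),
              eq7 (entry f 2) (dec7 10438202), eq7 (entry f 3) (dec7 4252409)
            & [/\ eq7 (entry f 4) (dec7 893946), entry f 5 = 0
                & entry f 6 = 0]],
          cosC R 6 f /\ vratio f = cosV R 6
        & [/\ I a, feasible2 a x, F2 x = r2 a
            & ratio2 a = inf (ratio2 @` I)]]].
Proof.
move=> I.
have [u ur Pu] := @crit_poly_root R.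
have ur1 := crit_range _ ur.
have ur2 : 27 / 25 <= u <= 119 / 100.
  by case/andP: ur; rewrite /crit_lo /crit_hi; clear; lra.
set x := opt_row u; set a := entry (sqmod_coef x) 1; set s := Num.sqrt a.
have Ia : I a by exact: opt_coef1_range.
have [/andP[a1 _] sr] := dec7_interval_range _ Ia.
have s1 : 0 < s - 1 by rewrite subr_gt0 -(sqrtr1 R) ltr_sqrt // (lt_trans _ a1).
have aE : a = s ^+ 2 by rewrite sqr_sqrtr // ltW // (lt_trans _ a1).
have xF := opt_feasible2 _ ur.
have xE : F2 x = curve_num u / curve_den u * (s - 1) ^+ 2.
  (* The sign is needed to identify s, a square root of a square, with u + w / A. *)
  have h0 : 0 <= u + Yden u / Ysum u.
    have tr : dual_range u by case/andP: ur2 => *; rewrite /dual_range; clear Pu; lra.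
    have [A0 w0 _] := dual_range_pos _ tr.
    have u0 : 0 <= u by case/andP: ur1 => u1 _; exact: le_trans u1.
    by rewrite addr_ge0 // divr_ge0 // ltW.
  by rewrite F2_opt_row // /s /a opt_coef1 // sqrtr_sqr ger0_norm.
have r2E : F2 x = r2 a.
  have [|y yF [<- ymin]] := @r2_attained _ a; first by exists x.
  apply/eqP; rewrite eq_le ymin // andbT xE.
  by apply: F2_lower => //; rewrite -aE.
have s0 : (s - 1) ^+ 2 != 0 by rewrite gt_eqF // exprn_gt0.
have ratioE : ratio2 a = curve_num u / curve_den u by rewrite /ratio2 -r2E xE mulfK.
(* Both infima are minima with the common value W(u), attained at [a] here and at [sqmod_coef x] in
   [VE]. *)
have infE : inf (ratio2 @` I) = curve_num u / curve_den u.
  apply: inf_min; first by exists a.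
  by move=> _ [b Ib <-]; exact: ratio2_lower.
have fC := opt_cosC _ ur.
have f0 : entry (sqmod_coef x) 0 = 1 by have [] := feasible2_coef _ _ xF.
have vE : vratio (sqmod_coef x) = curve_num u / curve_den u.
  by rewrite /vratio cospoly0 sum_sqmod_coef f0 sqrtr1 -/(F2 x) xE mulfK.
have VE : cosV R 6 = curve_num u / curve_den u.
  apply: inf_min; first by exists (sqmod_coef x).
  by move=> _ [f fC6 <-]; exact: vratio_lower.
have [c1 c2 c3 c4] := opt_coefs _ ur.
have [e0 e1 e2 e3 e4] := opt_entries _ ur.
have [c5 c6] := opt_coef56 u.
have e5 : entry x 5 = 0 by rewrite entry_unit_row // mul0r.
have e6 : entry x 6 = 0 by rewrite entry_unit_row // mul0r.
split; [by rewrite VE infE|by rewrite VE; exact: curve_value_eq7|exists x].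
split; [| |by rewrite vE VE|by rewrite ratioE infE].
  exact: (And5 e0 e1 e2 e3 (And3 e4 e5 e6)).
exact: (And5 f0 c1 c2 c3 (And3 c4 c5 c6)).
Qed.
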